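(* Let $G$ be a group together with an action on a set $\Omega$ of one of the following kinds: (i) $G$ acts faithfully by permutations on an infinite set $\Omega$ such that the algebraic closure operator $\mathrm{acl}$ of the action is locally finite and $(\Omega,\mathrm{acl})$ is an infinite-dimensional degenerate pregeometry (any action with no algebraicity is of this kind); (ii) $G=\mathrm{GL}(\kappa,K)$ or $G=\mathrm{PGL}(\kappa,K)$, where $\kappa$ is an infinite cardinal and $K$ is a field, with its natural action on $\Omega$, the $\kappa$-dimensional $K$-vector space, respectively the associated projective space. Let $r\ge 1$ and let $w=w(x_1,\dots,x_r)\in G*F_r$ be a regular word with constants in $G$. Then the set $$\{(g_1,\dots,g_r)\in G^r \mid w(g_1,\dots,g_r)\neq 1\}$$ is dense in $G^r$ with respect to the (product of the) topology of pointwise convergence on $G$ induced by the action on the discrete set $\Omega$. In particular, all mixed identities of $G$ are singular.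
   Context: Words. $F_r$ is the free group on generators $x_1,\dots,x_r$. A word with constants in $G$ in $r$ variables is an element $w$ of the free product $G*F_r$. For $(g_1,\dots,g_r)\in G^r$, $w(g_1,\dots,g_r)\in G$ is the image of $w$ under the homomorphism $G*F_r\to G$ which is the identity on $G$ and sends $x_i$ to $g_i$. The word $w$ is a mixed identity of $G$ if $w(g_1,\dots,g_r)=1$ for all $(g_1,\dots,g_r)\in G^r$. Let $\mathrm{rk}\colon G*F_r\to F_r$ be the homomorphism sending every element of $G$ to $1$ and fixing $F_r$ pointwise. The word $w$ is singular if $\mathrm{rk}(w)=1$, and regular otherwise. Algebraic closure. For $B\subseteq\Omega$, $G_B$ is the pointwise stabiliser of $B$. For finite $B\subseteq\Omega$, $\mathrm{acl}(B)$ is the set of $a\in\Omega$ such that the orbit $G_B\cdot a$ is finite; for infinite $C\subseteq\Omega$, $\mathrm{acl}(C)$ is the union of $\mathrm{acl}(B)$ over finite $B\subseteq C$. It is locally finite if $\mathrm{acl}(B)$ is finite for every finite $B$. The action has no algebraicity if $\mathrm{acl}(B)=B$ for all finite $B\subseteq\Omega$. The operator $\mathrm{acl}$ is always a closure operator of finite character; $(\Omega,\mathrm{acl})$ is a pregeometry if it satisfies exchange: $a\in\mathrm{acl}(A\cup\{b\})\setminus\mathrm{acl}(A)$ implies $b\in\mathrm{acl}(A\cup\{a\})$. It is degenerate if $\mathrm{acl}(A)=\bigcup_{a\in A}\mathrm{acl}(\{a\})$ for each $A\subseteq\Omega$. A set $A$ is independent if $b\notin\mathrm{acl}(A\setminus\{b\})$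 for all $b\in A$; a basis is an independent set $A$ with $\mathrm{acl}(A)=\Omega$; the pregeometry is infinite-dimensional if its bases (which all have the same cardinality) are infinite. Linear groups. $\mathrm{GL}(\kappa,K)$ is the group of all invertible $K$-linear maps of a $\kappa$-dimensional $K$-vector space $V$, and $\mathrm{PGL}(\kappa,K)$ is its quotient by the non-zero scalar maps, acting on the set of one-dimensional subspaces of $V$. Topology. The topology of pointwise convergence on $G$ has as a basis the sets $\{h\in G\mid h(\bar b)=\bar b'\}$, where $\bar b,\bar b'$ are finite tuples of elements of $\Omega$ of the same length; $G^r$ carries the product topology. *)

(* Defs.v *)
From HB Require Import structures.
From mathcomp Require Import all_boot all_algebra.
From mathcomp Require Import all_classical topology.

Set Implicit Arguments.
Unset Strict Implicit.
Unset Printing Implicit Defensive.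

Local Open Scope group_scope.
Local Open Scope classical_set_scope.
Local Open Scope quotient_scope.

(* Groups given by generators and relations: the quotient of the free monoid
   [seq T] by the congruence generated by [R], each letter having an inverse
   letter modulo this congruence. *)
Inductive gen_congr (T : Type) (R : seq T -> seq T -> Prop) :
    seq T -> seq T -> Prop :=
| gen_congr_rel u v : R u v -> gen_congr R u v
| gen_congr_refl u : gen_congr R u u
| gen_congr_sym u v : gen_congr R u v -> gen_congr R v u
| gen_congr_trans u v w :
    gen_congr R u v -> gen_congr R v w -> gen_congr R u w
| gen_congr_cat u u' v v' :
    gen_congr R u u' -> gen_congr R v v' -> gen_congr R (u ++ v) (u' ++ v').

Record presentation := Presentation {
  letter :> choiceType;
  letter_inv : letter -> letter;
  relator : seq letter -> seq letter -> Prop;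
  letter_mulV : forall t, gen_congr relator [:: t; letter_inv t] [::];
  letter_Vmul : forall t, gen_congr relator [:: letter_inv t; t] [::] }.

Section PresentedGroup.
Variable P : presentation.

Definition word_rel (u v : seq P) : bool := `[< gen_congr (@relator P) u v >].

Lemma word_rel_refl : reflexive word_rel.
Proof. by move=> u; apply/asboolP; exact: gen_congr_refl. Qed.

Lemma word_rel_sym : symmetric word_rel.
Proof.
by move=> u v; apply/asboolP/asboolP; exact: gen_congr_sym.
Qed.

Lemma word_rel_trans : transitive word_rel.
Proof.
move=> v u w /asboolP uv /asboolP vw; apply/asboolP.
exact: gen_congr_trans uv vw.
Qed.

Canonical word_equiv :=
  EquivRel word_rel word_rel_refl word_rel_sym word_rel_trans.

Definition presented : Type := {eq_quot word_rel}.
HB.instance Definition _ := Choice.copy presented {eq_quot word_rel}.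

Definition word_class (u : seq P) : presented := \pi_({eq_quot word_rel}) u.

Definition word_repr (x : presented) : seq P :=
  repr (x : {eq_quot word_rel}).

Lemma word_reprK x : word_class (word_repr x) = x.
Proof. exact: reprK. Qed.

Lemma word_classP u v :
  word_class u = word_class v <-> gen_congr (@relator P) u v.
Proof.
split=> [/eqmodP/asboolP //|uv]; apply/eqmodP/asboolP; exact: uv.
Qed.

Lemma repr_class u : gen_congr (@relator P) (word_repr (word_class u)) u.
Proof. by apply/word_classP; rewrite word_reprK. Qed.

Definition pone := word_class [::].
Definition pmul x y := word_class (word_repr x ++ word_repr y).
Definition pinv x := word_class (rev (map (@letter_inv P) (word_repr x))).

Lemma pmulE u v : pmul (word_class u) (word_class v) = word_class (u ++ v).
Proof. by apply/word_classP/gen_congr_cat; exact: repr_class. Qed.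

Lemma pmulA : associative pmul.
Proof.
move=> x y z; rewrite -(word_reprK x) -(word_reprK y) -(word_reprK z).
by rewrite !pmulE catA.
Qed.

Lemma pmul1 : left_id pone pmul.
Proof. by move=> x; rewrite -(word_reprK x) pmulE. Qed.

Lemma pmulr1 : right_id pone pmul.
Proof. by move=> x; rewrite -(word_reprK x) pmulE cats0. Qed.

Lemma pmulV : left_inverse pone pinv pmul.
Proof.
move=> x; rewrite -{2}(word_reprK x) pmulE; apply/word_classP.
elim: (word_repr x) => [|t u IHu]; first exact: gen_congr_refl.
rewrite /= rev_cons -cats1 -catA /=.
apply: gen_congr_trans IHu; apply: gen_congr_cat; first exact: gen_congr_refl.
rewrite -cat1s -[t :: u]cat1s catA -[X in gen_congr _ _ X]cat0s.
apply: gen_congr_cat; [exact: letter_Vmul|exact: gen_congr_refl].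
Qed.

Lemma pmulrV : right_inverse pone pinv pmul.
Proof.
move=> x; rewrite -{1}(word_reprK x) pmulE; apply/word_classP.
elim/last_ind: (word_repr x) => [|u t IHu]; first exact: gen_congr_refl.
rewrite map_rcons rev_rcons -cats1 -catA /=.
apply: gen_congr_trans IHu; apply: gen_congr_cat; first exact: gen_congr_refl.
rewrite -[X in gen_congr _ _ X]cat0s -[_ :: _ :: _]/([:: _; _] ++ _).
apply: gen_congr_cat; [exact: letter_mulV|exact: gen_congr_refl].
Qed.

HB.instance Definition _ :=
  isGroup.Build presented pmulA pmul1 pmulr1 pmulV pmulrV.

Section Lift.
Variables (H : groupType) (h : P -> H).

Definition seq_eval (u : seq P) : H := \prod_(t <- u) h t.

Definition plift (x : presented) : H := seq_eval (word_repr x).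

Hypothesis hR : forall u v, @relator P u v -> seq_eval u = seq_eval v.

Lemma seq_eval_congr u v :
  gen_congr (@relator P) u v -> seq_eval u = seq_eval v.
Proof.
elim=> {u v} [||u v _ //|u v w _ -> _ -> //|u u' v v' _ uu' _ vv'] //.
by rewrite /seq_eval !big_cat /= -/(seq_eval _) uu' -/(seq_eval v) vv'.
Qed.

Lemma plift_class u : plift (word_class u) = seq_eval u.
Proof. exact/seq_eval_congr/repr_class. Qed.

Lemma plift_morph : monoid_morphism plift.
Proof.
split=> [|x y]; first by rewrite plift_class /seq_eval big_nil.
rewrite -(word_reprK x) -(word_reprK y) [_ * _]pmulE !plift_class.
by rewrite /seq_eval big_cat.
Qed.

End Lift.

Lemma presented_ext (H : groupType) (f g : UMagmaMorphism.type presented H) :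
  (forall t, f (word_class [:: t]) = g (word_class [:: t])) -> f =1 g.
Proof.
move=> fg x; rewrite -(word_reprK x).
elim: (word_repr x) => [|t u IHu].
  by rewrite -[word_class [::]]/(1 : presented) !gmulf1.
have -> : word_class (t :: u) = word_class [:: t] * word_class u :> presented.
  by rewrite [RHS]pmulE.
by rewrite !gmulfM IHu fg.
Qed.

End PresentedGroup.

(* The free group on X: the letter [(x, false)] stands for x, and [(x, true)]
   for its inverse. *)
Section FreeGroup.
Variable X : choiceType.

Definition free_inv (t : X * bool) := (t.1, ~~ t.2).

Inductive free_rel : seq (X * bool) -> seq (X * bool) -> Prop :=
| free_cancel t : free_rel [:: t; free_inv t] [::].

Lemma free_mulV t : gen_congr free_rel [:: t; free_inv t] [::].
Proof. exact/gen_congr_rel/free_cancel. Qed.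

Lemma free_Vmul t : gen_congr free_rel [:: free_inv t; t] [::].
Proof.
have {2}-> : t = free_inv (free_inv t).
  by case: t => x b; rewrite /free_inv /= negbK.
exact: free_mulV.
Qed.

Definition free_presentation := Presentation free_mulV free_Vmul.

Definition free_group : Type := presented free_presentation.
HB.instance Definition _ := Group.on free_group.

Definition free_gen (x : X) : free_group :=
  @word_class free_presentation [:: (x, false)].

Section Lift.
Variables (H : groupType) (h : X -> H).

Definition free_lift : free_group -> H :=
  @plift free_presentation H (fun t => if t.2 then (h t.1)^-1 else h t.1).

Lemma free_lift_rel u v : free_rel u v ->
  seq_eval (P := free_presentation)
    (fun t => if t.2 then (h t.1)^-1 else h t.1) u =
  seq_eval (P := free_presentation)
    (fun t => if t.2 then (h t.1)^-1 else h t.1) v.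
Proof.
case=> -[x []]; rewrite /seq_eval big_nil !big_cons big_nil /= mulg1.
  by rewrite mulVg.
by rewrite mulgV.
Qed.

HB.instance Definition _ := isUMagmaMorphism.Build free_group H free_lift
  (plift_morph (P := free_presentation) free_lift_rel).

Lemma free_lift_gen x : free_lift (free_gen x) = h x.
Proof.
rewrite /free_lift plift_class; last exact: free_lift_rel.
by rewrite /seq_eval big_seq1.
Qed.

End Lift.

Lemma free_group_ext (H : groupType) (f g : UMagmaMorphism.type free_group H) :
  (forall x, f (free_gen x) = g (free_gen x)) -> f =1 g.
Proof.
move=> fg; apply: presented_ext => -[x []]; last exact: fg.
have -> : word_class (P := free_presentation) [:: (x, true)] =
    (free_gen x)^-1 :> free_group.
  apply: (mulgI (free_gen x)); rewrite mulgV [LHS]pmulE.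
  exact/word_classP/(free_mulV (x, false)).
by rewrite !gmulfV fg.
Qed.

End FreeGroup.

Section FreeProduct.
Variables A B : groupType.

Definition fprod_inv (t : A + B) : A + B :=
  match t with inl a => inl a^-1 | inr b => inr b^-1 end.

Inductive fprod_rel : seq (A + B) -> seq (A + B) -> Prop :=
| fprod_onel : fprod_rel [:: inl 1] [::]
| fprod_oner : fprod_rel [:: inr 1] [::]
| fprod_mull a a' : fprod_rel [:: inl a; inl a'] [:: inl (a * a')]
| fprod_mulr b b' : fprod_rel [:: inr b; inr b'] [:: inr (b * b')].

Lemma fprod_mulV t : gen_congr fprod_rel [:: t; fprod_inv t] [::].
Proof.
case: t => [a|b] /=.
  apply: gen_congr_trans (gen_congr_rel (fprod_mull _ _)) _.
  by rewrite mulgV; exact/gen_congr_rel/fprod_onel.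
apply: gen_congr_trans (gen_congr_rel (fprod_mulr _ _)) _.
by rewrite mulgV; exact/gen_congr_rel/fprod_oner.
Qed.

Lemma fprod_Vmul t : gen_congr fprod_rel [:: fprod_inv t; t] [::].
Proof.
have {2}-> : t = fprod_inv (fprod_inv t) by case: t => x /=; rewrite invgK.
exact: fprod_mulV.
Qed.

Definition fprod_presentation := Presentation fprod_mulV fprod_Vmul.

Definition free_product : Type := presented fprod_presentation.
HB.instance Definition _ := Group.on free_product.

Definition fprod_inl (a : A) : free_product :=
  @word_class fprod_presentation [:: inl a].
Definition fprod_inr (b : B) : free_product :=
  @word_class fprod_presentation [:: inr b].

Lemma fprod_inl_morph : monoid_morphism fprod_inl.
Proof.
split=> [|a a']; first exact/word_classP/gen_congr_rel/fprod_onel.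
rewrite [RHS]pmulE; apply/word_classP/gen_congr_sym/gen_congr_rel.
exact: fprod_mull.
Qed.
HB.instance Definition _ :=
  isUMagmaMorphism.Build A free_product fprod_inl fprod_inl_morph.

Lemma fprod_inr_morph : monoid_morphism fprod_inr.
Proof.
split=> [|b b']; first exact/word_classP/gen_congr_rel/fprod_oner.
rewrite [RHS]pmulE; apply/word_classP/gen_congr_sym/gen_congr_rel.
exact: fprod_mulr.
Qed.
HB.instance Definition _ :=
  isUMagmaMorphism.Build B free_product fprod_inr fprod_inr_morph.

Section Lift.
Variables (H : groupType).
Variables (f : UMagmaMorphism.type A H) (g : UMagmaMorphism.type B H).

Definition fprod_lift : free_product -> H := @plift fprod_presentation H
  (fun t => match t with inl a => f a | inr b => g b end).

Lemma fprod_lift_rel u v : fprod_rel u v ->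
  seq_eval (P := fprod_presentation)
    (fun t => match t with inl a => f a | inr b => g b end) u =
  seq_eval (P := fprod_presentation)
    (fun t => match t with inl a => f a | inr b => g b end) v.
Proof.
by case=> [||a a'|b b']; rewrite /seq_eval !big_cons ?big_nil ?mulg1
  ?gmulf1 ?gmulfM.
Qed.

HB.instance Definition _ := isUMagmaMorphism.Build free_product H fprod_lift
  (plift_morph (P := fprod_presentation) fprod_lift_rel).

Lemma fprod_lift_inl a : fprod_lift (fprod_inl a) = f a.
Proof.
rewrite /fprod_lift plift_class; last exact: fprod_lift_rel.
by rewrite /seq_eval big_seq1.
Qed.

Lemma fprod_lift_inr b : fprod_lift (fprod_inr b) = g b.
Proof.
rewrite /fprod_lift plift_class; last exact: fprod_lift_rel.
by rewrite /seq_eval big_seq1.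
Qed.

End Lift.

Lemma free_product_ext (H : groupType)
    (f g : UMagmaMorphism.type free_product H) :
    (forall a, f (fprod_inl a) = g (fprod_inl a)) ->
  (forall b, f (fprod_inr b) = g (fprod_inr b)) -> f =1 g.
Proof.
by move=> fgl fgr; apply: presented_ext => -[a|b]; [exact: fgl|exact: fgr].
Qed.

End FreeProduct.

Section Words.
Variables (G : groupType) (r : nat).

Definition word : Type := free_product G (free_group 'I_r).
HB.instance Definition _ := Group.on word.

Definition word_eval (g : 'I_r -> G) : word -> G :=
  fprod_lift idfun (free_lift g).

Definition rk : word -> free_group 'I_r := fprod_lift (one_fun _) idfun.

HB.instance Definition _ g := UMagmaMorphism.on (word_eval g).
HB.instance Definition _ := UMagmaMorphism.on rk.

Definition singular (w : word) : Prop := rk w = 1.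

Definition regular (w : word) : Prop := ~ singular w.

Definition mixed_identity (w : word) : Prop := forall g, word_eval g w = 1.

End Words.

Record action (G : groupType) (Omega : Type) := Action {
  act :> G -> Omega -> Omega;
  act1 : forall x, act 1 x = x;
  actM : forall g h x, act (g * h) x = act g (act h x) }.

Section AlgebraicClosure.
Variables (G : groupType) (Omega : choiceType) (to : action G Omega).
Implicit Types (A B C : set Omega) (a b : Omega).

Definition faithful : Prop := forall g, (forall x, to g x = x) -> g = 1.

Definition pstab B : set G := [set g | forall b, B b -> to g b = b].

Definition orbit (S : set G) a : set Omega := [set to g a | g in S].

Definition acl_fin B : set Omega := [set a | finite_set (orbit (pstab B) a)].

Definition acl C : set Omega :=
  if `[< finite_set C >] then acl_fin C
  else \bigcup_(B in [set B | finite_set B /\ B `<=` C]) acl_fin B.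

Lemma acl_finS A B : A `<=` B -> acl_fin A `<=` acl_fin B.
Proof.
move=> AB a; apply: sub_finite_set => _ [g gB <-].
by exists g => // b /AB; exact: gB.
Qed.

Lemma aclE C :
  acl C = \bigcup_(B in [set B | finite_set B /\ B `<=` C]) acl_fin B.
Proof.
rewrite /acl; case: asboolP => // finC.
apply/seteqP; split=> [a aC|a [B [_ BC]]]; last exact: acl_finS.
by exists C; [split|].
Qed.

Definition acl_locally_finite : Prop :=
  forall B, finite_set B -> finite_set (acl B).

Definition no_algebraicity : Prop := forall B, finite_set B -> acl B = B.

(* As acl is always a closure operator of finite character, (Omega, acl) is a
   pregeometry as soon as this property holds. *)
Definition exchange : Prop := forall A a b,
  (acl (A `|` [set b]) `\` acl A) a -> acl (A `|` [set a]) b.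

Definition acl_degenerate : Prop :=
  forall A, acl A = \bigcup_(a in A) acl [set a].

Definition acl_independent A : Prop :=
  forall b, A b -> ~ acl (A `\` [set b]) b.

Definition acl_basis A : Prop := acl_independent A /\ acl A = setT.

Definition acl_infinite_dimensional : Prop :=
  forall A, acl_basis A -> infinite_set A.

Record degenerate_kind : Prop := DegenerateKind {
  dk_faithful : faithful;
  dk_infinite : infinite_set [set: Omega];
  dk_locally_finite : acl_locally_finite;
  dk_exchange : exchange;
  dk_infinite_dimensional : acl_infinite_dimensional;
  dk_degenerate : acl_degenerate }.

Definition pointwise_group : Type :=
  initial_topology (to : G -> {ptws Omega -> discrete_topology Omega}).
HB.instance Definition _ := Topological.on pointwise_group.

Lemma pointwise_group_basis :
  basis [set U : set pointwise_group |
    exists n (b b' : 'I_n -> Omega), U = [set h | forall i, to h (b i) = b' i]].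
Proof.
split=> [_ [n [b [b' ->]]]|h U].
  pose A := [set f : {ptws Omega -> discrete_topology Omega} |
    forall i, f (b i) = b' i].
  suff oA : open A by exists A.
  rewrite openE => f fb.
  have : forall i, \forall g \near f, g (b i) = b' i.
    move=> i; apply: (@proj_continuous Omega (fun=> discrete_topology Omega)
      (b i) f [set b' i]).
    by rewrite /= /proj fb; exact: discrete_set1.
  by move=> /(filter_forall
    (nbhs_filter (f : {ptws Omega -> discrete_topology Omega}))).
rewrite /= nbhsE => -[_ [[A oA <-] Ah] AU].
pose F := filter_from (@finite_set Omega)
  (fun B => [set f : {ptws Omega -> discrete_topology Omega} |
               forall b, B b -> f b = to h b]).
have FF : Filter F.
  apply: filter_from_filter; first by exists set0; exact: finite_set0.
  move=> B C fB fC; exists (B `|` C); first by rewrite finite_setU.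
  by move=> f fBC; split=> b ?; apply: fBC; [left|right].
have Fh : F --> (to h : {ptws Omega -> discrete_topology Omega}).
  apply/cvg_sup => b V [_ [[W oW <-] Wh WV]].
  exists [set b]; first exact: finite_set1.
  by move=> f fb; apply: WV => /=; rewrite fb.
have [|B /finite_seqP[s ->] sA] := Fh A; first exact: open_nbhs_nbhs.
exists [set g : G | forall i, to g (tnth (in_tuple s) i) =
                              to h (tnth (in_tuple s) i)]; last first.
  move=> g gs; apply: AU; apply: sA => b /= /(tnthP (in_tuple s))[i ->].
  exact: gs.
by split=> //; exists (size s), (tnth (in_tuple s)),
  (fun i => to h (tnth (in_tuple s) i)).
Qed.

End AlgebraicClosure.

Section QuotientGroup.
Variable G : groupType.

Record normal_subgroup := NormalSubgroup {
  nsub : set G;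
  nsub1 : nsub 1;
  nsubM : forall x y, nsub x -> nsub y -> nsub (x * y);
  nsubV : forall x, nsub x -> nsub x^-1;
  nsubJ : forall x y, nsub x -> nsub (y^-1 * (x * y)) }.

Variable N : normal_subgroup.

Definition coset_rel (x y : G) : bool := `[< nsub N (x^-1 * y) >].

Lemma coset_rel_refl : reflexive coset_rel.
Proof. by move=> x; apply/asboolP; rewrite mulVg; exact: nsub1. Qed.

Lemma coset_rel_sym : symmetric coset_rel.
Proof.
by move=> x y; apply/asboolP/asboolP => /nsubV; rewrite invgM invgK.
Qed.

Lemma coset_rel_trans : transitive coset_rel.
Proof.
move=> y x z /asboolP xy /asboolP yz; apply/asboolP.
by have := nsubM xy yz; rewrite -mulgA mulVKg.
Qed.

Canonical coset_equiv :=
  EquivRel coset_rel coset_rel_refl coset_rel_sym coset_rel_trans.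

Definition quotient_group : Type := {eq_quot coset_rel}.
HB.instance Definition _ := Choice.copy quotient_group {eq_quot coset_rel}.

Definition coset_class (x : G) : quotient_group := \pi_({eq_quot coset_rel}) x.

Definition coset_repr (q : quotient_group) : G :=
  repr (q : {eq_quot coset_rel}).

Lemma coset_reprK q : coset_class (coset_repr q) = q.
Proof. exact: reprK. Qed.

Lemma coset_classP x y : coset_class x = coset_class y <-> nsub N (x^-1 * y).
Proof.
split=> [/eqmodP/asboolP //|xy]; apply/eqmodP/asboolP; exact: xy.
Qed.

Lemma coset_repr_class x : nsub N ((coset_repr (coset_class x))^-1 * x).
Proof. by apply/coset_classP; rewrite coset_reprK. Qed.

Definition qone := coset_class 1.
Definition qmul p q := coset_class (coset_repr p * coset_repr q).
Definition qinv q := coset_class (coset_repr q)^-1.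

Lemma qmulE x y : qmul (coset_class x) (coset_class y) = coset_class (x * y).
Proof.
apply/coset_classP; set x' := coset_repr _; set y' := coset_repr _.
have Nx : nsub N (x'^-1 * x) := coset_repr_class x.
have Ny : nsub N (y'^-1 * y) := coset_repr_class y.
have := nsubM (nsubJ y' Nx) Ny.
by rewrite invgM -!mulgA mulVKg.
Qed.

Lemma qinvE x : qinv (coset_class x) = coset_class x^-1.
Proof.
apply/coset_classP; rewrite invgK; set x' := coset_repr _.
have /nsubV/(nsubJ x'^-1) : nsub N (x'^-1 * x) := coset_repr_class x.
by rewrite invgM !invgK mulgK.
Qed.

Lemma qmulA : associative qmul.
Proof.
move=> x y z; rewrite -(coset_reprK x) -(coset_reprK y) -(coset_reprK z).
by rewrite !qmulE mulgA.
Qed.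

Lemma qmul1 : left_id qone qmul.
Proof. by move=> x; rewrite -(coset_reprK x) qmulE mul1g. Qed.

Lemma qmulr1 : right_id qone qmul.
Proof. by move=> x; rewrite -(coset_reprK x) qmulE mulg1. Qed.

Lemma qmulV : left_inverse qone qinv qmul.
Proof. by move=> x; rewrite -(coset_reprK x) qinvE qmulE mulVg. Qed.

Lemma qmulrV : right_inverse qone qinv qmul.
Proof. by move=> x; rewrite -(coset_reprK x) qinvE qmulE mulgV. Qed.

HB.instance Definition _ :=
  isGroup.Build quotient_group qmulA qmul1 qmulr1 qmulV qmulrV.

End QuotientGroup.

Import GRing.Theory.

Section LinearGroups.
Variables (K : fieldType) (V : lmodType K).

Local Open Scope ring_scope.

(* A basis of V indexed by I; the cardinal of I is then the dimension of V. *)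
Definition is_vbasis (I : choiceType) (e : I -> V) : Prop :=
  (forall (s : seq I) (c : I -> K), uniq s ->
     \sum_(i <- s) c i *: e i = 0 -> forall i, i \in s -> c i = 0) /\
  (forall v, exists (s : seq I) (c : I -> K), v = \sum_(i <- s) c i *: e i).

Record GL := MkGL {
  GL_fun :> V -> V;
  GL_linear : linear GL_fun;
  GL_bij : bijective GL_fun }.

HB.instance Definition _ := gen_eqMixin GL.
HB.instance Definition _ := gen_choiceMixin GL.

Implicit Types f g : GL.

Lemma GL_eqP f g : f =1 g -> f = g.
Proof.
case: f g => [f lf bf] [g lg bg] /= /funext fg; case: _ / fg in lg bg *.
by rewrite (Prop_irrelevance lf lg) (Prop_irrelevance bf bg).
Qed.

Lemma GL_id_linear : linear (@id V). Proof. by []. Qed.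

Definition GL_one := MkGL GL_id_linear (Bijective (frefl id) (frefl id)).

Lemma GL_comp_linear f g : linear (f \o g).
Proof. by move=> a u v; rewrite /= !GL_linear. Qed.

Definition GL_mul f g :=
  MkGL (GL_comp_linear f g) (bij_comp (GL_bij f) (GL_bij g)).

Lemma GL_ex_inv f : exists g : GL, cancel f g /\ cancel g f.
Proof.
have [h fK hK] := GL_bij f.
have lh : linear h.
  by move=> a u v; apply: (can_inj fK); rewrite GL_linear !hK.
by exists (MkGL lh (Bijective hK fK)).
Qed.

Definition GL_inv f : GL := projT1 (cid (GL_ex_inv f)).

Lemma GL_funK f : cancel f (GL_inv f).
Proof. by rewrite /GL_inv; case: cid => ? []. Qed.

Lemma GL_invK f : cancel (GL_inv f) f.
Proof. by rewrite /GL_inv; case: cid => ? []. Qed.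

Lemma GL_mulA : associative GL_mul.
Proof. by move=> f g h; apply: GL_eqP. Qed.

Lemma GL_mul1 : left_id GL_one GL_mul.
Proof. by move=> f; apply: GL_eqP. Qed.

Lemma GL_mulr1 : right_id GL_one GL_mul.
Proof. by move=> f; apply: GL_eqP. Qed.

Lemma GL_mulV : left_inverse GL_one GL_inv GL_mul.
Proof. by move=> f; apply: GL_eqP => v; exact: GL_funK. Qed.

Lemma GL_mulrV : right_inverse GL_one GL_inv GL_mul.
Proof. by move=> f; apply: GL_eqP => v; exact: GL_invK. Qed.

HB.instance Definition _ :=
  isGroup.Build GL GL_mulA GL_mul1 GL_mulr1 GL_mulV GL_mulrV.

Lemma GL_act1 (v : V) : GL_fun 1%g v = v. Proof. by []. Qed.

Lemma GL_actM f g (v : V) : (f * g)%g v = f (g v). Proof. by []. Qed.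

Definition GL_action : action GL V := Action GL_act1 GL_actM.

Definition scalar_maps : set GL :=
  [set f | exists2 c : K, c != 0 & forall v, f v = c *: v].

Lemma GL_scale f (c : K) v : f (c *: v) = c *: f v.
Proof.
have f0 : f 0 = 0.
  have := GL_linear f (-1) 0 0.
  by rewrite scaler0 addr0 scaleN1r addNr.
by have := GL_linear f c v 0; rewrite f0 !addr0.
Qed.

Lemma scalar_maps1 : scalar_maps 1%g.
Proof. by exists 1; [exact: oner_neq0|move=> v; rewrite scale1r]. Qed.

Lemma scalar_mapsM f g :
  scalar_maps f -> scalar_maps g -> scalar_maps (f * g)%g.
Proof.
move=> [c c0 fc] [d d0 gd]; exists (c * d); first exact: mulf_neq0.
by move=> v; rewrite GL_actM gd fc scalerA.
Qed.

Lemma scalar_mapsV f : scalar_maps f -> scalar_maps f^-1%g.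
Proof.
move=> [c c0 fc]; exists c^-1; first by rewrite invr_eq0.
move=> v; apply: (can_inj (GL_funK f)); rewrite [LHS]GL_invK fc scalerA.
by rewrite divff // scale1r.
Qed.

Lemma scalar_mapsJ f g :
  scalar_maps f -> scalar_maps (g^-1 * (f * g))%g.
Proof.
move=> [c c0 fc]; exists c => // v.
by rewrite !GL_actM fc GL_scale [X in c *: X]GL_funK.
Qed.

Definition GL_scalars : normal_subgroup GL :=
  NormalSubgroup scalar_maps1 scalar_mapsM scalar_mapsV scalar_mapsJ.

Definition PGL : Type := quotient_group GL_scalars.
HB.instance Definition _ := Group.on PGL.

Record proj_space := ProjPoint {
  line :> set V;
  line_dim1 : exists2 v, v != 0 & line = [set c *: v | c in [set: K]] }.

HB.instance Definition _ := gen_eqMixin proj_space.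
HB.instance Definition _ := gen_choiceMixin proj_space.

Implicit Type L : proj_space.

Lemma proj_eqP L M : line L = line M -> L = M.
Proof.
case: L M => [L hL] [M hM] /= LM; case: _ / LM in hM *.
by rewrite (Prop_irrelevance hL hM).
Qed.

Lemma GL_line_dim1 f L :
  exists2 v, v != 0 & f @` L = [set c *: v | c in [set: K]].
Proof.
have [v v0 ->] := line_dim1 L; exists (f v).
  apply: contra_neq v0 => fv0; apply: (can_inj (GL_funK f)).
  by rewrite fv0 -[in RHS](scale0r 0) GL_scale scale0r.
apply/seteqP; split=> [_ [_ [c _ <-] <-]|_ [c _ <-]].
  by exists c => //; rewrite GL_scale.
by exists (c *: v); [exists c|rewrite GL_scale].
Qed.

Definition GL_line f L : proj_space := ProjPoint (GL_line_dim1 f L).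

Lemma GL_line1 L : GL_line 1%g L = L.
Proof. by apply: proj_eqP => /=; exact: image_id. Qed.

Lemma GL_lineM f g L : GL_line (f * g)%g L = GL_line f (GL_line g L).
Proof. by apply: proj_eqP; rewrite /= -image_comp. Qed.

Lemma GL_line_scalar f L : scalar_maps f -> GL_line f L = L.
Proof.
move=> [c c0 fc]; apply: proj_eqP => /=.
have [v _ ->] := line_dim1 L; apply/seteqP; split=> [_ [_ [d _ <-] <-]|].
  by exists (c * d) => //; rewrite fc scalerA.
move=> _ [d _ <-]; exists ((c^-1 * d) *: v); first by exists (c^-1 * d).
by rewrite fc scalerA mulrA divff // mul1r.
Qed.

Definition PGL_act (q : PGL) L : proj_space := GL_line (coset_repr q) L.

Lemma PGL_actE f L : PGL_act (coset_class GL_scalars f) L = GL_line f L.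
Proof.
have /(GL_line_scalar L) := coset_repr_class GL_scalars f.
move=> /(congr1 (GL_line (coset_repr (coset_class GL_scalars f)))).
by rewrite -GL_lineM mulVKg.
Qed.

Lemma PGL_act1 L : PGL_act 1%g L = L.
Proof. by rewrite [LHS]PGL_actE GL_line1. Qed.

Lemma PGL_actM (p q : PGL) L : PGL_act (p * q)%g L = PGL_act p (PGL_act q L).
Proof. by rewrite [LHS]PGL_actE GL_lineM. Qed.

Definition PGL_action : action PGL proj_space := Action PGL_act1 PGL_actM.

End LinearGroups.

(* In the last two constructors an infinite type [kappa] plays the role of
   the infinite cardinal: V is kappa-dimensional as it has a basis indexed by
   [kappa]. *)
Inductive admissible : forall (G : groupType) (Omega : choiceType),
    action G Omega -> Prop :=
| admissible_degenerate (G : groupType) (Omega : choiceType)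
    (to : action G Omega) :
    degenerate_kind to -> admissible to
| admissible_GL (K : fieldType) (V : lmodType K) (kappa : choiceType)
    (e : kappa -> V) :
    infinite_set [set: kappa] -> is_vbasis e -> admissible (GL_action V)
| admissible_PGL (K : fieldType) (V : lmodType K) (kappa : choiceType)
    (e : kappa -> V) :
    infinite_set [set: kappa] -> is_vbasis e -> admissible (PGL_action V).

(* Main.v *)
(* After the substitution x_i -> h_i x_i it suffices to find, for a word w with
   rk w <> 1 and a finite set B, group elements fixing B pointwise at which w
   does not vanish.

   Degenerate pregeometries: being in the closure of a point is an equivalence
   relation with finite classes, and a point outside the classes of a finite
   set D can be moved off any finite set of classes by the stabiliser of D. Let
   w act on a point letter by letter, prescribing each new value generically.
   Label the visited points by elements of F_r so that constants preserve labels
   and x_i multiplies them by x_i: new values are generic even after applying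
   any of the constants, so the labels never clash. The path goes from label 1
   to label rk w <> 1, hence is not closed.

   Linear groups: the words whose values, on tuples fixing a large enough finite
   set F, are scalar modulo the span of F form a normal subgroup N. Modulo N,
   every word equals one with the same image under rk and without subwords
   x^e c x^-e with c in N. If such a reduced word still contains a letter, a
   generic path moves a vector off its own line modulo any given
   finite-dimensional subspace, so the word is not in N. Hence rk w = 1 for
   every w in N. *)
Require Import Defs.
From HB Require Import structures.
From mathcomp Require Import all_boot all_algebra.
From mathcomp Require Import all_classical topology.

Local Open Scope group_scope.
Local Open Scope classical_set_scope.

Set Implicit Arguments.
Unset Strict Implicit.
Unset Printing Implicit Defensive.

(** * Letters and words *)

Section Letters.
Variable r : nat.
Implicit Types (t : 'I_r * bool).

Definition flip t := (t.1, ~~ t.2).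

Lemma flipK : involutive flip.
Proof. by case=> i b; rewrite /flip negbK. Qed.

Definition signed (H : groupType) (g : 'I_r -> H) t : H :=
  if t.2 then (g t.1)^-1 else g t.1.

Lemma signed_flip (H : groupType) (g : 'I_r -> H) t :
  signed g (flip t) = (signed g t)^-1.
Proof. by case: t => i []; rewrite /signed //= invgK. Qed.

Definition free_letter t : free_group 'I_r := signed (@free_gen 'I_r) t.

Section Words.
Variable G : groupType.
Implicit Types (g : 'I_r -> G) (w : word G r).

Definition const (c : G) : word G r := fprod_inl _ c.

Definition wletter t : word G r := fprod_inr G (free_letter t).

Lemma rkM w w' : rk (w * w') = rk w * rk w'.
Proof. exact: gmulfM. Qed.

Lemma evalM g w w' : word_eval g (w * w') = word_eval g w * word_eval g w'.
Proof. exact: gmulfM. Qed.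

Lemma rk_const c : rk (const c) = 1.
Proof. exact: fprod_lift_inl. Qed.

Lemma rk_wletter t : rk (wletter t) = free_letter t.
Proof. exact: fprod_lift_inr. Qed.

Lemma eval_const g c : word_eval g (const c) = c.
Proof. exact: fprod_lift_inl. Qed.

Lemma eval_wletter g t : word_eval g (wletter t) = signed g t.
Proof.
rewrite [LHS]fprod_lift_inr /free_letter /signed.
by case: t.2; rewrite ?gmulfV /= free_lift_gen.
Qed.

Lemma constM c d : const (c * d) = const c * const d.
Proof. exact: gmulfM. Qed.

Lemma wletter_flip t : wletter (flip t) = (wletter t)^-1.
Proof. by rewrite /wletter /free_letter signed_flip gmulfV. Qed.

(** Each free-group entry in a representative of w is itself split into letters, which are then put
    in front one at a time. *)
Lemma word_ind (P : word G r -> Prop) :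
    P 1 -> (forall c w, P w -> P (const c * w)) ->
  (forall t w, P w -> P (wletter t * w)) -> forall w, P w.
Proof.
move=> P1 Pc Pt w; rewrite -(word_reprK w).
elim: (word_repr w) => [//|x u IHu].
have -> : word_class (x :: u) = word_class [:: x] * word_class u :> word G r.
  by rewrite [RHS]pmulE.
case: x => [c|f]; first exact: Pc.
rewrite -/(fprod_inr G f) -(word_reprK f).
elim: (word_repr f) => [|x v IHv].
  rewrite -[word_class [::]]/(1 : free_group 'I_r).
  by rewrite gmulf1 mul1g.
have -> : word_class (x :: v) =
    free_letter x * (word_class v : free_group 'I_r) :> free_group 'I_r.
  have -> : free_letter x = word_class (P := free_presentation _) [:: x].
    case: x => i [] //; apply: (mulgI (free_gen i)).
    rewrite mulgV [RHS]pmulE; apply/word_classP/gen_congr_sym.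
    exact: (free_mulV (i, false)).
  by rewrite [RHS]pmulE.
by rewrite gmulfM -mulgA; exact: Pt.
Qed.

End Words.
End Letters.

(** * Partial maps prescribed on finite sets *)

Section PartialActions.
Variables (r : nat) (G : groupType) (Omega : choiceType) (to : action G Omega).
Implicit Types (g : 'I_r -> G) (t : 'I_r * bool).

(* A triple [(t, x, y)] prescribes that the letter t maps x to y. *)
Definition edge := (('I_r * bool) * Omega * Omega)%type.
Implicit Type D : seq edge.

(** Edges are stored in both directions, so that t and its inverse are treated alike and the targets
    of t-edges are the sources of [flip t]-edges. *)
Definition flip_closed D :=
  forall t x y, (t, x, y) \in D -> (flip t, y, x) \in D.

Definition compatible D g :=
  forall t x y, (t, x, y) \in D -> to (signed g t) x = y.

Definition constant_edges (B : seq Omega) : seq edge :=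
  [seq (t, b, b) | t <- enum {: 'I_r * bool}, b <- B].

Lemma mem_constant_edges B t x y :
  ((t, x, y) \in constant_edges B) = (x \in B) && (y == x).
Proof.
apply/allpairsP/andP => [[[s b] [_ bB [_ -> ->]]]|[xB /eqP->]] //.
by exists (t, x); rewrite mem_enum.
Qed.

Lemma flip_closed_constant B : flip_closed (constant_edges B).
Proof.
move=> t x y; rewrite !mem_constant_edges => /andP[xB /eqP->].
by rewrite xB eqxx.
Qed.

Lemma compatible_constant1 B : compatible (constant_edges B) (fun=> 1).
Proof.
move=> t x y; rewrite mem_constant_edges => /andP[_ /eqP->].
by rewrite /signed invg1 if_same act1.
Qed.

Lemma act_eq_inv c x y : to c x = y -> to c^-1 y = x.
Proof. by move=> <-; rewrite -actM mulVg act1. Qed.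

Lemma compatible_fix D B g : {subset constant_edges B <= D} ->
  compatible D g -> forall i b, b \in B -> to (g i) b = b.
Proof.
move=> BD gD i b bB; apply: (gD (i, false)); apply: BD.
by rewrite mem_constant_edges bB eqxx.
Qed.

(** Multiplying the value of t on the right by h keeps every t-edge, as h fixes its source; the
    edges of [flip t] are the same edges reversed. For an inverse letter this replaces g_i by h^-1
    g_i. *)
Lemma compatible_twist D g t h : flip_closed D -> compatible D g ->
    (forall x y, (t, x, y) \in D -> to h x = x) ->
  exists2 g', compatible D g' & signed g' t = signed g t * h.
Proof.
move=> DF gD hD; case: t hD => i e hD.
pose g' j := if j == i then if e then h^-1 * g j else g j * h else g j.
have g'E : signed g' (i, e) = signed g (i, e) * h.
  rewrite /signed /g' /= eqxx; clear; case: e => //.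
  by rewrite invgM invgK.
exists g' => // -[j d] x y xyD.
case: (eqVneq j i) xyD => [-> xyD|nji xyD]; last first.
  by rewrite -(gD _ _ _ xyD) /signed /g' /= (negPf nji).
have g'e u v : ((i, e), u, v) \in D -> to (signed g' (i, e)) u = v.
  by move=> uvD; rewrite g'E actM (hD _ _ uvD); exact: gD uvD.
have [de|de] := eqVneq d e; first by rewrite de in xyD *; exact: g'e.
have {}de : (i, d) = flip (i, e).
  by rewrite /flip /=; clear -de; case: d e de => [] [].
rewrite de signed_flip; apply: act_eq_inv; apply: g'e.
by rewrite -[(i, e)]flipK -de; exact: DF xyD.
Qed.

Lemma compatible_extend D g t h x y : flip_closed D -> compatible D g ->
    (forall u v, (t, u, v) \in D -> to h u = u) ->
    to (signed g t * h) x = y ->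
  let D' := [:: (t, x, y), (flip t, y, x) & D] in
  flip_closed D' /\ exists g', compatible D' g'.
Proof.
move=> DF gD hD hxy /=; split.
  move=> s u v; rewrite !inE => /or3P[] => [/eqP[-> -> ->]|/eqP[-> -> ->]|uvD].
  - by rewrite eqxx orbT.
  - by rewrite flipK eqxx.
  - by rewrite (DF _ _ _ uvD) !orbT.
have [g' g'D g't] := compatible_twist DF gD hD.
exists g' => s u v; rewrite !inE => /or3P[] => [/eqP[-> -> ->]|/eqP[-> -> ->]|].
- by rewrite g't.
- by rewrite signed_flip g't; exact: act_eq_inv.
- exact: g'D.
Qed.

End PartialActions.

(** * Degenerate pregeometries *)

Section Degenerate.
Variables (r : nat) (G : groupType) (Omega : choiceType) (to : action G Omega).
Variable R : Omega -> Omega -> Prop.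
Hypothesis R_refl : forall a, R a a.
Hypothesis R_sym : forall a b, R a b -> R b a.
Hypothesis R_trans : forall a b c, R a b -> R b c -> R a c.
Hypothesis R_act : forall g a b, R a b -> R (to g a) (to g b).
Hypothesis R_move : forall (D C : seq Omega) a,
  (forall d, d \in D -> ~ R a d) ->
  exists2 h, (forall d, d \in D -> to h d = d) &
             (forall c, c \in C -> ~ R (to h a) c).
Variables (x0 : Omega) (B : seq Omega).

Implicit Types (T : seq (Omega * free_group 'I_r)) (S : seq G).

(** Edges that start in B are exempt; by [avoiding], the path never needs them. *)
Definition labelled T (D : seq (edge r Omega)) := forall t x y,
  (t, x, y) \in D -> x \in B \/
  exists2 a, (x, a) \in T & (y, free_letter t * a) \in T.

(** This is required of the translates by S, as a later constant might bring visited points with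
    different labels into one class. *)
Definition separated S T := forall c c' p p' a a',
  c \in S -> c' \in S -> (p, a) \in T -> (p', a') \in T ->
  R (to c p) (to c' p') -> a = a'.

Definition avoiding S T := forall c p a b,
  c \in S -> (p, a) \in T -> b \in B -> ~ R (to c p) b.

(* The partial maps D send x to p along w; S is a finite set of constants that
   may still be applied to the visited points T. *)
Definition tree_path S (w : word G r) := exists x T (D : seq (edge r Omega)),
  [/\ flip_closed D, {subset constant_edges r B <= D},
      exists g, compatible to D g & labelled T D] /\
  [/\ separated S T, avoiding S T, (x, 1) \in T &
    exists2 p, (p, rk w) \in T &
      forall g, compatible to D g -> R (to (word_eval g w) x) p].

Lemma R_act_inv c a b : R (to c a) b -> R a (to c^-1 b).
Proof. by move/(R_act c^-1); rewrite -actM mulVg act1. Qed.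

Lemma tree_path1 S : tree_path S 1.
Proof.
(* The start is moved off the classes of all c^-1 b, so that no constant c in S takes it into the
   class of a point b of B. *)
have [|h _ hC] := @R_move [::] [seq to c^-1 b | c <- S, b <- B] x0; first by [].
exists (to h x0), [:: (to h x0, 1)], (constant_edges r B); split; split=> //.
- exact: flip_closed_constant.
- by exists (fun=> 1); exact: compatible_constant1.
- by move=> t x y; rewrite mem_constant_edges => /andP[]; left.
- move=> c c' p p' a a' _ _; rewrite !inE => /eqP[_ ->] /eqP[_ ->] //.
- move=> c p a b cS; rewrite inE => /eqP[-> _] bB /R_act_inv; apply: hC.
  by apply/allpairsP; exists (c, b).
- by rewrite inE.
exists (to h x0); first by rewrite inE gmulf1.
by move=> g _; rewrite gmulf1 act1.
Qed.

Lemma tree_path_const w c :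
  (forall S, tree_path S w) -> forall S, tree_path S (const r c * w).
Proof.
(* The visited points get their images under c as companions. Applying d to c q is applying [d * c]
   to q, hence the larger set of constants. *)
move=> IH S; have := IH (S ++ map (fun d => d * c) S).
move=> [x [T [D [[DF BD gD TD] [sepT avT x1 [p pT wp]]]]]].
pose T' := T ++ [seq (to c q.1, q.2) | q <- T].
have lift d q a : d \in S -> (q, a) \in T' -> exists d' q', [/\
    d' \in S ++ map (fun d => d * c) S, (q', a) \in T & to d q = to d' q'].
  move=> dS; rewrite mem_cat => /orP[qT|/mapP[[q' a'] q'T [-> ->]]].
    by exists d, q; rewrite mem_cat dS.
  exists (d * c), q'; rewrite mem_cat actM; split=> //.
  by apply/orP; right; apply/mapP; exists d.
exists x, T', D; split; split=> //.
- move=> t u v /TD[|[a ua va]]; [by left|right].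
  by exists a; rewrite mem_cat ?ua ?va.
- move=> d d' q q' a a' dS d'S /(lift _ _ _ dS)[e [u [eS uT ->]]].
  by move=> /(lift _ _ _ d'S)[e' [u' [e'S u'T ->]]]; exact: sepT.
- move=> d q a b dS /(lift _ _ _ dS)[e [u [eS uT ->]]]; exact: avT uT.
- by rewrite mem_cat x1.
exists (to c p).
  rewrite rkM rk_const mul1g mem_cat; apply/orP; right.
  by apply/mapP; exists (p, rk w).
by move=> g /wp; rewrite evalM eval_const actM; exact: R_act.
Qed.

Lemma tree_path_letter w t :
  (forall S, tree_path S w) -> forall S, tree_path S (wletter G t * w).
Proof.
move=> IH S; have := IH (1 :: S).
move=> [x [T [D [[DF BD [g gD] TD] [sepT avT x1 [p pT wp]]]]]].
have S1 : 1 \in 1 :: S by rewrite inE eqxx.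
have rkE : rk (wletter G t * w) = free_letter t * rk w.
  by rewrite rkM rk_wletter.
(* If p lies in the class of a source d of a t-edge, its image is determined up to R: d is not in B
   and carries the label of p, so d' carries the label wanted. *)
have [[d [d' [dD pd]]]|nD] :=
  pselect (exists d d', (t, d, d') \in D /\ R p d).
  exists x, T, D; split; split=> //.
  - by exists g.
  - by move=> c c' q q' a a' cS c'S; apply: sepT; rewrite inE ?cS ?c'S orbT.
  - by move=> c q a b cS; apply: avT; rewrite inE cS orbT.
  exists d'; last first.
    move=> g' g'D; rewrite evalM eval_wletter actM -(g'D _ _ _ dD).
    by apply/R_act/(R_trans _ pd)/wp.
  case: (TD _ _ _ dD) => [dB|[a da d'a]].
    by case: (@avT 1 p (rk w) d); rewrite // act1.
  by rewrite rkE; have <- : a = rk w by apply: (sepT 1 1 d p); rewrite // !act1;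
    exact: R_sym.
pose Dt := [seq e.1.2 | e <- D & e.1.1 == t].
have memDt d d' : (t, d, d') \in D -> d \in Dt.
  by move=> dD; apply/mapP; exists (t, d, d'); rewrite // mem_filter eqxx.
pose S' := 1 :: S; pose s := signed g t.
(* Once h p is off the classes of C, no constant in S' takes q = s h p into the class of a point of
   B or of a translate of a visited point. *)
pose C := [seq to (c * s)^-1 b | c <- S', b <- B] ++
  [seq to (c * s)^-1 (to c'q.1 c'q.2.1) | c <- S',
     c'q <- [seq (c', q) | c' <- S', q <- T]].
have [|h hD hC] := @R_move Dt C p.
  move=> d /mapP[[[t' d1] d2]]; rewrite mem_filter => /andP[/eqP /= ->] dD ->.
  by move=> pd; apply: nD; exists d1, d2.
pose q := to (s * h) p.
have qB c b : c \in S' -> b \in B -> ~ R (to c q) b.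
  move=> cS bB; rewrite /q actM -actM => /R_act_inv; apply: hC.
  by rewrite mem_cat; apply/orP; left; apply/allpairsP; exists (c, b).
have qT c c' q' a : c \in S' -> c' \in S' -> (q', a) \in T ->
    ~ R (to c q) (to c' q').
  move=> cS c'S q'T; rewrite /q actM -actM => /R_act_inv; apply: hC.
  rewrite mem_cat; apply/orP; right; apply/allpairsP.
  exists (c, (c', (q', a))); split=> //; apply/allpairsP.
  by exists (c', (q', a)).
have [DF' [g' g'D]] :=
  @compatible_extend _ _ _ to D g t h p q DF gD
    (fun u v uv => hD u (memDt u v uv)) erefl.
set D' := _ :: _ in DF' g'D.
pose T' := (q, free_letter t * rk w) :: T.
have DD' : {subset D <= D'} by move=> e eD; rewrite !inE eD !orbT.
exists x, T', D'; split; split=> //.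
- by move=> e /BD/DD'.
- by exists g'.
- move=> s' u v; rewrite !inE => /or3P[] => [/eqP[-> -> ->]|/eqP[-> -> ->]|uv].
  + by right; exists (rk w); rewrite inE ?pT ?orbT ?eqxx.
  + right; exists (free_letter t * rk w); rewrite inE ?eqxx //.
    by rewrite /free_letter signed_flip mulKg pT orbT.
  + case: (TD _ _ _ uv) => [|[a ua va]]; [by left|right].
    by exists a; rewrite inE ?ua ?va orbT.
- have SS' c : c \in S -> c \in S' by rewrite inE => ->; rewrite orbT.
  move=> c c' u u' a a' /SS' cS /SS' c'S.
  rewrite !inE => /orP[/eqP[-> ->]|uT] /orP[/eqP[-> ->]|u'T] //.
  + by move=> /(qT _ _ _ _ cS c'S u'T).
  + by move=> /R_sym /(qT _ _ _ _ c'S cS uT).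
  + exact: sepT.
- move=> c u a b cS; have cS' : c \in S' by rewrite inE cS orbT.
  rewrite inE => /orP[/eqP[-> _]|uT] bB; first exact: qB.
  exact: avT uT bB.
- by rewrite inE x1 orbT.
exists q; first by rewrite rkE inE eqxx.
move=> g1 g1D; rewrite evalM eval_wletter actM.
have <- : to (signed g1 t) p = q by apply: g1D; rewrite inE eqxx.
by apply/R_act/wp => s' u v uv; apply/g1D/DD'.
Qed.

Lemma tree_path_word w S : tree_path S w.
Proof.
elim/word_ind: w S => [|c w IH|t w IH] S; first exact: tree_path1.
  exact: tree_path_const.
exact: tree_path_letter.
Qed.

(** If w took the value 1, the end p of the path would lie in the class of its start x, although
    their labels are [rk w] and 1. *)
Lemma degenerate_nonidentity (w : word G r) : rk w <> 1 ->
  exists g, (forall i b, b \in B -> to (g i) b = b) /\ word_eval g w <> 1.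
Proof.
move=> w1; have := tree_path_word w [:: 1].
move=> [x [T [D [[DF BD [g gD] TD] [sepT avT x1 [p pT wp]]]]]].
exists g; split; first exact: compatible_fix BD gD.
move=> gw; apply/w1/esym; apply: (sepT 1 1 x p); rewrite ?inE // !act1.
by rewrite -[x](act1 to) -gw; exact: wp.
Qed.

End Degenerate.

(** * Closures of single points *)

Section AclFacts.
Variables (G : groupType) (Omega : choiceType) (to : action G Omega).
Implicit Types (A : set Omega) (a b c : Omega).

Lemma acl_finE A : finite_set A -> acl to A = acl_fin to A.
Proof. by rewrite /acl => /asboolT ->. Qed.

Lemma acl1E a : acl to [set a] = acl_fin to [set a].
Proof. exact/acl_finE/finite_set1. Qed.

Lemma orbit_finite_subset (S : set G) a A :
  finite_set A -> (forall g, S g -> A (to g a)) ->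
  finite_set (Defs.orbit to S a).
Proof. by move=> fA SA; apply: sub_finite_set fA => _ [g Sg <-]; exact: SA. Qed.

Lemma acl1_refl a : acl to [set a] a.
Proof.
rewrite acl1E; apply: (@orbit_finite_subset _ _ [set a]).
  exact: finite_set1.
by move=> g ga; exact: ga.
Qed.

(* Split the orbit of a under the stabiliser of c according to the finitely
   many images of b. *)
Lemma acl1_trans a b c :
  acl to [set b] a -> acl to [set c] b -> acl to [set c] a.
Proof.
rewrite !acl1E => ab bc.
pose k b' := xget 1 [set g | pstab to [set c] g /\ to g b = b'].
apply: (@orbit_finite_subset _ _
  (\bigcup_(b' in Defs.orbit to (pstab to [set c]) b)
     [set to (k b') y | y in Defs.orbit to (pstab to [set b]) a])).
  by apply: bigcup_finite => // b' _; exact: finite_image.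
move=> g gc; exists (to g b); first by exists g.
have [kc kb] : pstab to [set c] (k (to g b)) /\ to (k (to g b)) b = to g b.
  by rewrite /k; case: xgetP => [_ -> //|/(_ g)[]].
exists (to ((k (to g b))^-1 * g) a); last by rewrite -actM mulVKg.
exists ((k (to g b))^-1 * g) => // _ ->.
by rewrite actM; exact: act_eq_inv kb.
Qed.

Lemma acl1_act g a b : acl to [set b] a -> acl to [set to g b] (to g a).
Proof.
rewrite !acl1E => ab.
apply: (@orbit_finite_subset _ _
  [set to g y | y in Defs.orbit to (pstab to [set b]) a]).
  exact: finite_image.
move=> h hgb; exists (to (g^-1 * h * g) a); last first.
  by rewrite -actM !mulgA mulgV mul1g actM.
exists (g^-1 * h * g) => // _ ->; rewrite !actM (hgb (to g b)) //.
by rewrite -actM mulVg act1.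
Qed.

(** Here [acl] is the identity on infinite sets too, so the only basis is Omega. *)
Lemma no_algebraicity_kind : faithful to -> infinite_set [set: Omega] ->
  no_algebraicity to -> degenerate_kind to.
Proof.
move=> ft iO na; have aclI A : acl to A = A.
  rewrite aclE; apply/seteqP; split=> [a [B [fB BA]]|a Aa].
    by rewrite -acl_finE // na //; exact: BA.
  exists [set a]; first by split; [exact: finite_set1|move=> _ ->].
  by rewrite -acl1E; exact: acl1_refl.
split=> //.
- by move=> B; rewrite aclI.
- by move=> A a b; rewrite !aclI => -[[Aa nAa|-> _]]; [case: nAa|right].
- by move=> A [_]; rewrite aclI => ->.
- move=> A; rewrite aclI; apply/seteqP; split=> [a Aa|b [a Aa]].
    by exists a; rewrite // aclI.
  by rewrite aclI => ->.
Qed.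

End AclFacts.

(** Density at the identity tuple, for all regular words; translation carries it to the other
    tuples. *)
Definition moved_off_finite (G : groupType) (Omega : choiceType)
    (to : action G Omega) : Prop :=
  forall r (w : word G r) (B : seq Omega), rk w <> 1 ->
  exists g, (forall i b, b \in B -> to (g i) b = b) /\ word_eval g w <> 1.

Lemma degenerate_moved_off (G : groupType) (Omega : choiceType)
  (to : action G Omega) : degenerate_kind to -> moved_off_finite to.
Proof.
move=> [_ iO lf ex _ dg] r w B w1.
have acl0 : acl to set0 = set0 by rewrite dg bigcup_set0.
have [x0 _] := infinite_setN0 iO.
pose R a b := acl to [set b] a.
apply: (@degenerate_nonidentity _ _ _ to R) => //.
- exact: acl1_refl.
(* Symmetry is exchange over the empty set, whose closure is empty by degeneracy. *)
- move=> a b ab; have := ex set0 a b; rewrite !set0U acl0 setD0.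
  exact.
- by move=> a b c ab bc; exact: acl1_trans bc.
- by move=> g a b; exact: acl1_act.
move=> D C a Da.
have finD : finite_set [set` D] by exact: finite_seq.
(* By degeneracy a is outside the closure of D, so its orbit is infinite and leaves the closure of
   C, which is finite by local finiteness. *)
have infa : infinite_set (Defs.orbit to (pstab to [set` D]) a).
  move=> fa; have : acl to [set` D] a by rewrite acl_finE.
  by rewrite dg => -[d dD]; exact: Da.
have finC : finite_set (acl to [set` C]) by apply/lf/finite_seq.
have [_ [[h hD <-] hC]] := infinite_setN0 (infinite_setD infa finC).
exists h => [d dD|c cC hac]; first exact: hD.
by apply: hC; rewrite dg; exists c.
Qed.

(** * Density *)

Section Density.
Variables (G : groupType) (Omega : choiceType) (to : action G Omega) (r : nat).

Lemma substitute_translates (h : 'I_r -> G) (w : word G r) :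
  exists2 w' : word G r, rk w' = rk w &
    forall y, word_eval y w' = word_eval (fun i => h i * y i) w.
Proof.
elim/word_ind: w => [|c w [w' rkw w'E]|t w [w' rkw w'E]].
- by exists 1 => // y; rewrite !gmulf1.
- exists (const r c * w'); first by rewrite !rkM rkw.
  by move=> y; rewrite !evalM !eval_const w'E.
case: t => i e.
(* The inverse letter x_i^-1 becomes x_i^-1 h_i^-1, with the constant on its right. *)
exists (if e then wletter G (i, e) * const r (h i)^-1 * w'
        else const r (h i) * wletter G (i, e) * w').
  by case: e; rewrite !rkM rkw !rk_const ?mulg1 ?mul1g.
move=> y; case: e; rewrite !evalM !eval_const !eval_wletter w'E //.
by rewrite /signed /= invgM.
Qed.

(** The sets of tuples that agree with h on a finite set B, the same for all coordinates, generate a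
    filter converging to h in each coordinate. *)
Lemma agree_nbhs (h : {ptws 'I_r -> pointwise_group to})
    (O : set {ptws 'I_r -> pointwise_group to}) : open O -> O h ->
  exists B : seq Omega, forall g : 'I_r -> G,
    (forall i b, b \in B -> to (g i) b = to (h i) b) -> O g.
Proof.
move=> oO Oh.
pose F := filter_from [set: seq Omega]
  (fun B => [set g : {ptws 'I_r -> pointwise_group to} |
               forall i b, b \in B -> to (g i) b = to (h i) b]).
have FF : Filter F.
  apply: filter_from_filter; first by exists [::].
  move=> B C _ _; exists (B ++ C) => // g gBC.
  by split=> i b bB; apply: gBC; rewrite mem_cat bB ?orbT.
have Fh : F --> h.
  apply/cvg_sup => i V [_ [[W oW <-] Wh WV]].
  have [_ /(_ (h i) W)] := pointwise_group_basis to.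
  rewrite /= => -[|_ [[n [b [b' ->]]] hb bW]]; first exact: open_nbhs_nbhs.
  exists (codom b) => // g gb; apply: WV; apply: bW => k /=.
  by rewrite gb ?hb ?codom_f.
have [|B _ BO] := Fh O; first exact: open_nbhs_nbhs.
by exists B => g gB; exact: BO.
Qed.

Lemma regular_dense (w : word G r) : moved_off_finite to -> regular w ->
  dense ([set g | word_eval g w <> 1] : set {ptws 'I_r -> pointwise_group to}).
Proof.
move=> mo w1 O [h Oh] oO.
have [B BO] := agree_nbhs oO Oh.
have [w' rkw w'E] := substitute_translates h w.
have [|y [yB yw]] := mo r w' B; first by rewrite rkw.
exists (fun i => h i * y i); split=> /=; last by rewrite -w'E.
by apply: BO => i b bB; rewrite actM yB.
Qed.

End Density.

(** * Linear groups *)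

Section Span.
Import GRing.Theory.
Local Open Scope ring_scope.
Variables (K : fieldType) (V : lmodType K).
Implicit Types (F : seq V) (u v : V).

(* V is infinite-dimensional, so {vspace V} is not available. *)
Inductive in_span F : V -> Prop :=
| in_span_mem v of v \in F : in_span F v
| in_span0 : in_span F 0
| in_spanP (a : K) u v of in_span F u & in_span F v : in_span F (a *: u + v).

Lemma in_span_sub F (P : V -> Prop) : P 0 ->
  (forall (a : K) x y, P x -> P y -> P (a *: x + y)) ->
  (forall x, x \in F -> P x) -> forall v, in_span F v -> P v.
Proof. by move=> P0 PD PF v; elim=> {v} [v /PF|//|a u v _ Pu _]; auto. Qed.

Lemma in_spanZ F (a : K) v : in_span F v -> in_span F (a *: v).
Proof. by move=> vF; rewrite -[_ *: _]addr0; exact: in_spanP (in_span0 F). Qed.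

Lemma in_spanD F u v : in_span F u -> in_span F v -> in_span F (u + v).
Proof. by move=> uF vF; rewrite -[u]scale1r; exact: in_spanP. Qed.

Lemma in_spanN F v : in_span F v -> in_span F (- v).
Proof. by rewrite -scaleN1r; exact: in_spanZ. Qed.

Lemma in_spanB F u v : in_span F u -> in_span F v -> in_span F (u - v).
Proof. by move=> uF vF; exact/in_spanD/in_spanN/vF. Qed.

Lemma in_span_trans F F' v :
  (forall x, x \in F -> in_span F' x) -> in_span F v -> in_span F' v.
Proof.
by move=> FF'; apply: in_span_sub => //; [exact: in_span0|exact: in_spanP].
Qed.

Lemma in_spanS F F' v : {subset F <= F'} -> in_span F v -> in_span F' v.
Proof. by move=> FF'; apply: in_span_trans => x /FF'/in_span_mem. Qed.

Lemma in_span_cons u F v :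
  in_span (u :: F) v -> exists k : K, in_span F (v - k *: u).
Proof.
move: v; apply: in_span_sub => [|a x y [k xk] [l yl]|x].
- by exists 0; rewrite scale0r subr0; exact: in_span0.
- exists (a * k + l); rewrite scalerDl -scalerA opprD addrACA -scalerBr.
  exact: in_spanP.
rewrite inE => /orP[/eqP->|xF]; [exists 1|exists 0].
  by rewrite scale1r subrr; exact: in_span0.
by rewrite scale0r subr0; exact: in_span_mem.
Qed.

Lemma in_span_consl u F (k : K) v :
  in_span F (v - k *: u) -> in_span (u :: F) v.
Proof.
move=> vF; rewrite -[v](subrK (k *: u)); apply: in_spanD.
  by apply: in_spanS vF => x xF; rewrite inE xF orbT.
by apply/in_spanZ/in_span_mem; rewrite inE eqxx.
Qed.

Lemma in_spanZr F (k : K) v : k != 0 -> in_span F (k *: v) -> in_span F v.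
Proof. by move=> k0 /(in_spanZ k^-1); rewrite scalerK. Qed.

Lemma GLD (f : GL V) u v : f (u + v) = f u + f v.
Proof. by have := GL_linear f 1 u v; rewrite !scale1r. Qed.

Lemma GL0 (f : GL V) : f 0 = 0.
Proof. by rewrite -[X in f X](scale0r 0) GL_scale scale0r. Qed.

Lemma GLB (f : GL V) u v : f (u - v) = f u - f v.
Proof. by rewrite GLD -scaleN1r GL_scale scaleN1r. Qed.

Lemma GLVK (f : GL V) : cancel (f^-1)%g f.
Proof. exact: GL_invK. Qed.

Lemma GLKV (f : GL V) : cancel f (f^-1)%g.
Proof. exact: GL_funK. Qed.

Lemma in_span_image (f : GL V) F F' v :
  (forall x, x \in F -> in_span F' (f x)) -> in_span F v -> in_span F' (f v).
Proof.
move=> fF; move: v; apply: in_span_sub => //.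
  by rewrite GL0; exact: in_span0.
by move=> a x y fx fy; rewrite GL_linear; exact: in_spanP.
Qed.

Definition functional (phi : V -> K) :=
  forall a u v, phi (a *: u + v) = a * phi u + phi v.

Lemma functional0 phi : functional phi -> phi 0 = 0.
Proof.
by move=> fp; have := fp (-1) 0 0; rewrite scaler0 addr0 mulN1r addNr.
Qed.

Lemma functionalB phi u v : functional phi -> phi (u - v) = phi u - phi v.
Proof. by move=> fp; rewrite addrC -scaleN1r fp mulN1r addrC. Qed.

Lemma functionalZ phi a v : functional phi -> phi (a *: v) = a * phi v.
Proof. by move=> fp; rewrite -[a *: v]addr0 fp functional0 // addr0. Qed.

Lemma functional_comb phi psi (b : K) : functional phi -> functional psi ->
  functional (fun v => phi v + b * psi v).
Proof.
move=> fp fq a u v; rewrite fp fq !mulrDr -!addrA; congr (_ + _).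
by rewrite addrCA mulrCA addrCA.
Qed.

Lemma functional_span phi F v : functional phi ->
  (forall x, x \in F -> phi x = 0) -> in_span F v -> phi v = 0.
Proof.
move=> fp pF; move: v; apply: in_span_sub => //; first exact: functional0.
by move=> a x y px py; rewrite fp px py mulr0 addr0.
Qed.

(** * Coordinates with respect to a basis *)

Section Coordinates.
Variables (kappa : choiceType) (e : kappa -> V).
Hypothesis eP : is_vbasis e.

(** The list s0 bounds the support of f. Summing over every duplicate-free list that contains s0
    lets two expansions be compared on a common list. *)
Definition coords v (f : kappa -> K) := exists2 s0 : seq kappa,
  (forall i, i \notin s0 -> f i = 0) &
  forall s, uniq s -> {subset s0 <= s} -> v = \sum_(i <- s) f i *: e i.

Lemma coords0 : coords 0 (fun=> 0).
Proof.
by exists [::] => // s _ _; rewrite big1 // => i _; rewrite scale0r.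
Qed.

Lemma coordsP a u v f g : coords u f -> coords v g ->
  coords (a *: u + v) (fun i => a * f i + g i).
Proof.
move=> [s f0 fs] [s' g0 gs]; exists (s ++ s') => [i|t ut st].
  by rewrite mem_cat negb_or => /andP[/f0-> /g0->]; rewrite mulr0 addr0.
rewrite (fs t) ?(gs t) // => [|i|i]; try by move=> ?; apply: st;
  rewrite mem_cat; apply/orP; auto.
rewrite scaler_sumr -big_split /=.
by apply: eq_bigr => i _; rewrite scalerDl scalerA.
Qed.

Lemma coords_basis i : coords (e i) (fun j => (j == i)%:R).
Proof.
exists [:: i] => [j|s us si]; first by rewrite inE => /negPf->.
rewrite (bigD1_seq i) ?si ?inE //= eqxx scale1r big1 ?addr0 // => j /negPf->.
by rewrite scale0r.
Qed.

Lemma coords_exist v : exists f, coords v f.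
Proof.
have [s [c ->]] := eP.2 v; elim: s => [|i s [f fs]].
  by exists (fun=> 0); rewrite big_nil; exact: coords0.
(* The list of indices may have repetitions; their coefficients add up. *)
exists (fun j => c i * (j == i)%:R + f j); rewrite big_cons.
exact/coordsP/fs/coords_basis.
Qed.

Lemma coords_inj v f g : coords v f -> coords v g -> f = g.
Proof.
move=> [s f0 fs] [s' g0 gs]; apply/funext => i.
pose t := undup (s ++ s').
have [it|] := boolP (i \in t); last first.
  by rewrite mem_undup mem_cat negb_or => /andP[/f0-> /g0->].
apply/eqP; rewrite -subr_eq0; apply/eqP.
apply: (eP.1 t (fun i => f i - g i)) it; first exact: undup_uniq.
under eq_bigr do rewrite scalerBl.
rewrite sumrB -fs -?gs ?subrr ?undup_uniq // => j js;
  by rewrite mem_undup mem_cat js ?orbT.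
Qed.

Definition coordinate i v : K := projT1 (cid (coords_exist v)) i.

Lemma coordinateE v f : coords v f -> coordinate^~ v = f.
Proof.
by move=> vf; apply: coords_inj vf; rewrite /coordinate; case: cid.
Qed.

Lemma coordinateP v : coords v (coordinate^~ v).
Proof. by have [f vf] := coords_exist v; rewrite (coordinateE vf). Qed.

Lemma coordinate_functional i : functional (coordinate i).
Proof.
move=> a u v.
by have /coordinateE/(congr1 (@^~ i)) :=
  coordsP a (coordinateP u) (coordinateP v).
Qed.

Lemma vbasis_separates v : v != 0 -> exists2 phi, functional phi & phi v != 0.
Proof.
move=> v0; apply: contrapT => nphi.
have vi i : coordinate i v = 0.
  apply: contrapT => /eqP vi; apply: nphi.
  by exists (coordinate i); first exact: coordinate_functional.
have [s _ vs] := coordinateP v; move/eqP: v0; apply.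
rewrite (vs (undup s)) ?undup_uniq // => [|i]; last by rewrite mem_undup.
by rewrite big1 // => i _; rewrite vi scale0r.
Qed.

(** Only finitely many coordinates are non-zero somewhere on F. Any other one vanishes on the span
    of F but not at its own basis vector. *)
Lemma vbasis_infinite F :
  infinite_set [set: kappa] -> exists v, ~ in_span F v.
Proof.
move=> ik.
have [s sF] : exists s : seq kappa,
    forall x, x \in F -> forall i, i \notin s -> coordinate i x = 0.
  elim: F => [|x F [s sF]]; first by exists [::].
  have [s' xs' _] := coordinateP x.
  exists (s' ++ s) => y; rewrite inE => /orP[/eqP->|/sF yF] i;
    by rewrite mem_cat negb_or => /andP[? ?]; auto.
have [i [_ /= /negP is_]] := infinite_setN0 (infinite_setD ik (finite_seq s)).
exists (e i) => /(functional_span (coordinate_functional i)) ei0.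
have := oner_neq0 K; rewrite -ei0 => [|x xF]; last exact: sF is_.
have /(congr1 (@^~ i)) /= -> := coordinateE (coords_basis i).
by rewrite eqxx eqxx.
Qed.

End Coordinates.

(** * Functionals, transitivity and scalars modulo a finite set *)

Section InfiniteDimensional.
Hypothesis separates : forall v, v != 0 ->
  exists2 phi, functional phi & phi v != 0.
Hypothesis infdim : forall F, exists v, ~ in_span F v.

(** Induction on F. If u is outside the span of F, take phi vanishing on F with phi u non-zero, and
    psi for the projection of v along u; subtracting a multiple of phi makes psi vanish at u. *)
Lemma functional_off F v : ~ in_span F v -> exists phi,
  [/\ functional phi, forall x, x \in F -> phi x = 0 & phi v != 0].
Proof.
elim: F v => [|u F IH] v vF.
  have [|phi fp pv] := @separates v; last by exists phi.
  by apply/eqP => v0; apply: vF; rewrite v0; exact: in_span0.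
have [uF|uF] := pselect (in_span F u).
  have [|phi [fp pF pv]] := IH v.
    by move=> vF'; apply: vF; apply: in_spanS vF' => x xF; rewrite inE xF orbT.
  exists phi; split=> // x; rewrite inE => /orP[/eqP->|/pF//].
  exact: functional_span uF.
have [phi [fp pF pu]] := IH u uF.
have [|psi [fq qF qv]] := IH (v - (phi v / phi u) *: u).
  by move=> /in_span_consl.
exists (fun x => psi x + - (psi u / phi u) * phi x); split.
- exact: functional_comb.
- move=> x; rewrite inE => /orP[/eqP->|xF]; last first.
    by rewrite (qF x xF) (pF x xF) mulr0 addr0.
  by rewrite mulNr divfK // subrr.
- rewrite mulNr [_ / _ * _]mulrC [psi u / _]mulrC mulrA.
  by move: qv; rewrite functionalB // functionalZ.
Qed.

(** Of two functionals, one non-zero at u and one at v, either one is non-zero at both vectors or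
    their sum is; rescaling gives the value 1 at u. *)
Lemma functional_off2 F u v : ~ in_span F u -> ~ in_span F v -> exists phi,
  [/\ functional phi, forall x, x \in F -> phi x = 0, phi u = 1 & phi v != 0].
Proof.
move=> uF vF.
suff [phi [fp pF pu pv]] : exists phi,
    [/\ functional phi, forall x, x \in F -> phi x = 0, phi u != 0
      & phi v != 0].
  exists (fun x => 0 + (phi u)^-1 * phi x); split.
  - by apply: functional_comb => // a x y; rewrite mulr0 addr0.
  - by move=> x xF; rewrite (pF x xF) mulr0 addr0.
  - by rewrite add0r mulVf.
  - by rewrite add0r mulf_neq0 ?invr_eq0.
have [phi [fp pF pu]] := functional_off uF.
have [pv|pv] := eqVneq (phi v) 0; last by exists phi.
have [psi [fq qF qv]] := functional_off vF.
have [qu|qu] := eqVneq (psi u) 0; last by exists psi.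
exists (fun x => phi x + 1 * psi x); split.
- exact: functional_comb.
- by move=> x xF; rewrite (pF x xF) (qF x xF) mulr0 addr0.
- by rewrite qu mulr0 addr0.
- by rewrite pv mul1r add0r.
Qed.

(* The map is x + phi x (v - u) for a functional phi vanishing on F with
   phi u = 1; its determinant is phi v. *)
Lemma GL_move F u v : ~ in_span F u -> ~ in_span F v ->
  exists2 h : GL V, forall x, x \in F -> h x = x & h u = v.
Proof.
move=> uF vF; have [phi [fp pF pu pv]] := functional_off2 uF vF.
pose h x := x + phi x *: (v - u).
pose h' x := x - (phi x / phi v) *: (v - u).
have lh : linear h.
  by move=> a x y; rewrite /h fp scalerDl addrACA -scalerA -scalerDr.
have hK : cancel h h'.
  move=> x; rewrite /h'.
  suff -> : phi (h x) / phi v = phi x by rewrite addrK.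
  rewrite /h addrC fp functionalB // pu mulrBr mulr1 subrK mulfK //.
have h'K : cancel h' h.
  move=> x; rewrite /h.
  suff -> : phi (h' x) = phi x / phi v by rewrite subrK.
  rewrite /h' functionalB // functionalZ // functionalB // pu.
  by rewrite mulrBr mulr1 divfK // opprB addrC subrK.
exists (MkGL lh (Bijective hK h'K)) => [x xF|] /=; rewrite /h.
  by rewrite pF // scale0r addr0.
by rewrite pu scale1r addrC subrK.
Qed.

(** In other words, k preserves the span of F and induces a non-zero scalar on the quotient. *)
Definition scalar_mod F (k : GL V) := exists2 l : K, l != 0 &
  forall v, in_span F (k v - l *: v).

Lemma scalar_modS F F' k :
  {subset F <= F'} -> scalar_mod F k -> scalar_mod F' k.
Proof. by move=> FF' [l l0 kl]; exists l => // v; exact: in_spanS (kl v). Qed.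

Lemma scalar_modM F k k' :
  scalar_mod F k -> scalar_mod F k' -> scalar_mod F (k * k')%g.
Proof.
move=> [l l0 kl] [l' l0' kl']; exists (l * l'); first exact: mulf_neq0.
move=> v; rewrite GL_actM -[X in in_span _ X](subrKA (l *: k' v)).
by rewrite -scalerA -scalerBr; exact: in_spanD (in_spanZ _ (kl' v)).
Qed.

Lemma scalar_modV F k : scalar_mod F k -> scalar_mod F k^-1%g.
Proof.
move=> [l l0 kl]; exists l^-1; first by rewrite invr_eq0.
move=> v; have /(in_spanZ (- l^-1)) := kl ((k^-1)%g v).
by rewrite GLVK scalerBr !scaleNr scalerK // opprK addrC.
Qed.

Lemma scalar_modJ F F' (k c : GL V) : (forall x, x \in F -> in_span F' (c x)) ->
  scalar_mod F k -> scalar_mod F' (c * k * c^-1)%g.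
Proof.
move=> cF [l l0 kl]; exists l => // v; rewrite !GL_actM.
have := in_span_image cF (kl ((c^-1)%g v)).
by rewrite GLB GL_scale GLVK.
Qed.

(** Modulo the span of F every line is preserved; the factors at two independent vectors u and v
    agree, as both equal the factor at u + v. *)
Lemma scalar_modP F (k : GL V) :
  (forall u, ~ in_span F u -> in_span (u :: F) (k u)) -> scalar_mod F k.
Proof.
move=> kF; have [u uF] := infdim F.
have [l ul] := in_span_cons (kF u uF).
have off v : ~ in_span (u :: F) v -> in_span F (k v - l *: v).
  move=> vuF; have vF : ~ in_span F v.
    by move=> vF; apply: vuF; apply: in_spanS vF => x xF; rewrite inE xF orbT.
  have uvF : ~ in_span F (u + v).
    move=> uvF; apply/vuF/(@in_span_consl _ _ (- 1)).
    by rewrite scaleN1r opprK addrC.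
  have [m vm] := in_span_cons (kF v vF).
  have [n uvn] := in_span_cons (kF _ uvF).
  have := in_spanB (in_spanD ul vm) uvn.
  have -> : k u - l *: u + (k v - m *: v) - (k (u + v) - n *: (u + v)) =
      (n - m) *: v - (l - n) *: u.
    rewrite GLD addrACA -opprD opprB [LHS]addrC subrKA scalerDr opprD addrACA.
    by rewrite !scalerBl opprB addrC.
  move=> nml.
  have nm : n = m.
    apply/eqP; rewrite -subr_eq0; apply: contrapT => /negP nm.
    apply: vuF; apply: in_spanZr nm _; apply: in_span_consl nml.
  move: nml; rewrite nm subrr scale0r sub0r -scaleNr => nml.
  have lm : l = m.
    apply/eqP; rewrite -subr_eq0 -oppr_eq0; apply: contrapT => /negP lm.
    by apply: uF; exact: in_spanZr nml.
  by rewrite lm.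
(* A vector v in the span of [u :: F] is (v + w) - w, with both terms outside that span. *)
have [w wuF] := infdim (u :: F).
have kl v : in_span F (k v - l *: v).
  have [vuF|] := pselect (in_span (u :: F) v); last exact: off.
  have vwuF : ~ in_span (u :: F) (v + w).
    by move=> vw; apply: wuF; have := in_spanB vw vuF; rewrite addrC addKr.
  have := in_spanB (off _ vwuF) (off _ wuF).
  by rewrite GLD scalerDr opprD addrACA addrK.
exists l => //; apply/eqP => l0; apply: uF.
by have := kl ((k^-1)%g u); rewrite l0 scale0r subr0 GLVK.
Qed.

(** * Words with constants in the general linear group *)

Section LinearWords.
Variable r : nat.
Local Open Scope group_scope.
Implicit Types (g : 'I_r -> GL V) (w : word (GL V) r) (t : 'I_r * bool).
Implicit Types (c : GL V) (s : seq (('I_r * bool) * GL V)).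

Definition fixing F g := forall i x, x \in F -> g i x = x.

Lemma fixing_letter F g t x : fixing F g -> x \in F -> signed g t x = x.
Proof.
move=> gF xF; rewrite /signed; case: t.2; last exact: gF.
by rewrite -[in LHS](gF t.1 x xF) GLKV.
Qed.

(** This is the normal subgroup N. The set F may depend on the word; products and conjugation by
    constants enlarge it. *)
Definition asymp_scalar w :=
  exists F, forall g, fixing F g -> scalar_mod F (word_eval g w).

Lemma asymp_scalarM w w' :
  asymp_scalar w -> asymp_scalar w' -> asymp_scalar (w * w').
Proof.
move=> [F wF] [F' wF']; exists (F ++ F') => g gFF'.
have sub : {subset F <= F ++ F'} by move=> x xF; rewrite mem_cat xF.
have sub' : {subset F' <= F ++ F'} by move=> x xF; rewrite mem_cat xF orbT.
rewrite evalM; apply: scalar_modM.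
  by apply/(scalar_modS sub)/wF => i x /sub; exact: gFF'.
by apply/(scalar_modS sub')/wF' => i x /sub'; exact: gFF'.
Qed.

Lemma asymp_scalarV w : asymp_scalar w -> asymp_scalar w^-1.
Proof.
by move=> [F wF]; exists F => g /wF; rewrite gmulfV; exact: scalar_modV.
Qed.

Lemma asymp_scalarJ_const c w :
  asymp_scalar w -> asymp_scalar (const r c * w * (const r c)^-1).
Proof.
move=> [F wF]; exists (F ++ [seq GL_fun c x | x <- F]) => g gF.
rewrite !evalM gmulfV /= eval_const; apply: (@scalar_modJ F).
  by move=> x xF; apply: in_span_mem; rewrite mem_cat map_f ?orbT.
by apply: wF => i x xF; apply: gF; rewrite mem_cat xF.
Qed.

Lemma asymp_scalarJ_letter t w :
  asymp_scalar w -> asymp_scalar (wletter (GL V) t * w * (wletter (GL V) t)^-1).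
Proof.
move=> [F wF]; exists F => g gF.
rewrite !evalM gmulfV /= eval_wletter; apply: (@scalar_modJ F); last exact: wF.
by move=> x xF; rewrite (fixing_letter _ gF xF); exact: in_span_mem.
Qed.

Lemma asymp_scalar_const F c : scalar_mod F c -> asymp_scalar (const r c).
Proof. by move=> cF; exists F => g _; rewrite eval_const. Qed.

Definition syllables s : word (GL V) r :=
  foldr (fun tc w => wletter (GL V) tc.1 * (const r tc.2 * w)) 1 s.

Definition cancels t s := if s is (t', _) :: _ then t == flip t' else false.

(** A constant belongs to N when it is scalar modulo some F; none such may stand between mutually
    inverse letters. *)
Fixpoint reduced s := if s is (t, c) :: s' then
  (cancels t s' -> forall F, ~ scalar_mod F c) /\ reduced s' else True.

(** A new constant is absorbed into the leading one. A new letter opens a syllable, unless it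
    encloses an element of N together with the next letter; then the enclosed part is dropped. *)
Lemma normal_form w : exists c s, [/\ reduced s, rk (syllables s) = rk w &
  asymp_scalar (const r c * syllables s * w^-1)].
Proof.
elim/word_ind: w => [|c w [c0 [s [sr rks ws]]]|t w [c [s [sr rks ws]]]].
- exists 1, [::]; split=> //; rewrite [const _ _]gmulf1 invg1 !mulg1.
  exists [::] => g _; rewrite gmulf1; exists 1%R; first exact: oner_neq0.
  by move=> v; rewrite scale1r subrr; exact: in_span0.
- exists (c * c0), s; split=> //; first by rewrite rkM rk_const mul1g.
  have := asymp_scalarJ_const c ws.
  by rewrite constM invgM !mulgA.
have [[tc [F cF]]|nred] := pselect (cancels t s /\ exists F, scalar_mod F c);
  last first.
  exists 1, ((t, c) :: s); split.
  - by split=> // tc F cF; apply: nred; split=> //; exists F.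
  - by rewrite /= !rkM rk_const mul1g rk_wletter rks.
  have := asymp_scalarJ_letter t ws.
    by rewrite [const _ 1]gmulf1 mul1g /= invgM !mulgA.
case: s sr rks ws tc => // -[t' c'] s [_ sr] rks ws /eqP tE.
exists c', s; split=> //.
  rewrite !rkM -rks /= !rkM rk_const mul1g !rk_wletter tE.
  by rewrite /free_letter signed_flip mulKg.
(* The relation for w conjugated by t, multiplied on the left by the inverse of t c t^-1, is the
   relation for t w. *)
have := asymp_scalarJ_letter t ws.
have := asymp_scalarV (asymp_scalarJ_letter t (asymp_scalar_const cF)).
move=> /asymp_scalarM /[apply]; rewrite tE wletter_flip /= !invgM !invgK.
by rewrite !mulgA mulgK mulgVK mulVg mul1g.
Qed.

Local Notation gl := (GL_action V).

Definition path_state (B : seq V) s u v (D : seq (edge r V)) :=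
  [/\ flip_closed D, {subset constant_edges r B <= D},
      exists g, compatible gl D g &
      forall g, compatible gl D g -> word_eval g (syllables s) v = u].

(** Any u outside the span of F and c^-1 F together will do. *)
Lemma off_span c F : exists2 u, ~ in_span F u & ~ in_span F (c u).
Proof.
have [u uF] := infdim (F ++ [seq GL_fun c^-1 x | x <- F]).
exists u => uF'; apply: uF.
  by apply: in_spanS uF' => x xF; rewrite mem_cat xF.
have := @in_span_image c^-1 F (F ++ [seq GL_fun c^-1 x | x <- F]) _ _ uF'.
by rewrite GLKV; apply=> x xF; apply: in_span_mem; rewrite mem_cat map_f ?orbT.
Qed.

(* The last point u of the path may be chosen arbitrarily outside F, which makes
   it possible to take the next constant and letter into account. *)
Lemma generic_path B s : reduced s ->
  exists2 F, (forall x, x \in B -> in_span F x) &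
  forall u, ~ in_span F u -> exists v D, path_state B s u v D /\
    [/\ ~ in_span B v, s <> [::] -> in_span F v,
        forall t x y, (t, x, y) \in D -> in_span (u :: F) x &
        forall t x y, (t, x, y) \in D -> ~~ cancels t s -> in_span F x].
Proof.
elim: s => [_|[t c] s IH [tc sr]].
  exists B => [x|u uB]; first exact: in_span_mem.
  exists u, (constant_edges r B); split; split=> //.
  - exact: flip_closed_constant.
  - by exists (fun=> 1); exact: compatible_constant1.
  - by move=> g _; rewrite gmulf1.
  - move=> t x y; rewrite mem_constant_edges => /andP[xB _].
    by apply: in_span_mem; rewrite inE xB orbT.
  - move=> t x y; rewrite mem_constant_edges => /andP[xB _] _.
    exact: in_span_mem.
have [F BF FP] := IH sr.
(* If t undoes the letter applied last, then u is the source of a t-edge, and c u has to avoid u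
   modulo F as well. Were this impossible, c would be scalar modulo F. *)
have [u uF cu] : exists2 u, ~ in_span F u &
    ~ in_span (if cancels t s then u :: F else F) (c u).
  case: (boolP (cancels t s)) => [/tc cF|_]; last exact: off_span.
  apply: contrapT => ncu; apply: (cF F); apply: scalar_modP => u uF.
  by apply: contrapT => cuF; apply: ncu; exists u.
have [v [D [[DF BD [g0 g0D] gv] [vB vF Du Dc]]]] := FP u uF.
pose F' := [:: u, c u, v & F].
have FF' x : in_span F x -> in_span F' x.
  by apply: in_spanS => y yF; rewrite !inE yF !orbT.
have uFF' x : in_span (u :: F) x -> in_span F' x.
  by apply: in_spanS => y; rewrite !inE => /orP[]->; rewrite ?orbT.
have cuF' : in_span F' (c u) by apply: in_span_mem; rewrite !inE eqxx orbT.
have vF' : in_span F' v by apply: in_span_mem; rewrite !inE eqxx !orbT.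
exists F' => [x xB|u' u'F']; first exact/FF'/BF.
have consF' x : in_span F' x -> in_span (u' :: F') x.
  by apply: in_spanS => y yF; rewrite inE yF orbT.
pose Dt := [seq e.1.2 | e <- D & e.1.1 == t].
have memDt x : x \in Dt -> exists y, (t, x, y) \in D.
  move=> /mapP[[[t' x'] y]]; rewrite mem_filter => /andP[/eqP/= -> xyD] ->.
  by exists y.
have cuDt : ~ in_span Dt (c u).
  move=> cuDt; apply: cu; apply: in_span_trans cuDt => x /memDt[y xyD].
  by case: ifPn => [_|/(Dc _ _ _ xyD)//]; exact: Du xyD.
(* [g0] takes the sources of t-edges to their targets, which are sources of reversed edges and hence
   in the span of F'; u' is outside that span. *)
have u'Dt : ~ in_span Dt ((signed g0 t)^-1%g u').
  move=> u'Dt; apply: u'F'.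
  have := @in_span_image (signed g0 t : GL V) Dt F' _ _ u'Dt.
  rewrite GLVK; apply.
  move=> x /memDt[y xyD]; apply: uFF'.
  by have /= -> := g0D _ _ _ xyD; apply: Du (DF _ _ _ xyD).
have [h hDt hcu] := GL_move cuDt u'Dt.
have hu' : gl (signed g0 t * h) (c u) = u' by rewrite actM /= hcu GLVK.
have [|DF' D'g] := compatible_extend DF g0D _ hu'.
  move=> x y xyD; apply: hDt; apply/mapP; exists (t, x, y) => //.
  by rewrite mem_filter eqxx.
exists v, [:: (t, c u, u'), (flip t, u', c u) & D]; split; split=> //.
- by move=> e /BD eD; rewrite !inE eD !orbT.
- move=> g gD'; rewrite /= !evalM eval_wletter eval_const !GL_actM gv.
    by apply: gD'; rewrite inE eqxx.
  by move=> t' x y xyD; apply: gD'; rewrite !inE xyD !orbT.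
- move=> t' x y; rewrite !inE => /or3P[] => [/eqP[_ -> _]|/eqP[_ -> _]|xyD].
  + exact: consF'.
  + by apply: in_span_mem; rewrite inE eqxx.
  + exact/consF'/uFF'/(Du _ _ _ xyD).
- move=> t' x y; rewrite !inE.
  move=> /or3P[] => [/eqP[_ -> _]|/eqP[-> _ _]|xyD _] //.
  + by rewrite /= eqxx.
  + exact/uFF'/(Du _ _ _ xyD).
Qed.

(** A generic path leads from v in the span of F to some u with c u outside it, so c u is not a
    multiple of v modulo the span of B. *)
Lemma reduced_not_asymp_scalar c s : reduced s -> s <> [::] ->
  ~ asymp_scalar (const r c * syllables s).
Proof.
move=> sr s0 [B wB].
have [F BF FP] := generic_path B sr.
have [u uF cuF] := off_span c F.
have [v [D [[DF BD [g gD] gv] [vB /(_ s0) vF _ _]]]] := FP u uF.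
have gB : fixing B g by exact: compatible_fix BD gD.
have [l _ /(_ v)] := wB g gB.
rewrite evalM eval_const GL_actM gv // => cuv; apply: cuF.
rewrite -[c u](subrK (l *: v)%R); apply/in_spanD/in_spanZ/vF.
exact: in_span_trans BF cuv.
Qed.

Lemma asymp_scalar_singular w : asymp_scalar w -> rk w = 1.
Proof.
move=> wN; have [c [s [sr <- sw]]] := normal_form w.
have [->|s0] := pselect (s = [::]); first exact: gmulf1.
have := asymp_scalarM sw wN; rewrite mulgVK.
by move/(reduced_not_asymp_scalar sr s0).
Qed.

(** Values outside the scalars, and not merely different from 1, are what the projective group
    requires. *)
Lemma regular_fixing_not_scalar w (B : seq V) : rk w <> 1 ->
  exists2 g, fixing B g & ~ scalar_maps (word_eval g w).
Proof.
move=> w1; apply: contrapT => nex; apply/w1/asymp_scalar_singular.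
exists B => g gB.
have [l l0 gl] : scalar_maps (word_eval g w).
  by apply: contrapT => gw; apply: nex; exists g.
by exists l => // v; rewrite gl subrr; exact: in_span0.
Qed.

End LinearWords.
End InfiniteDimensional.
End Span.

(** * Passage to the linear and projective actions *)

Lemma GL_moved_off (K : fieldType) (V : lmodType K) (kappa : choiceType)
    (e : kappa -> V) : infinite_set [set: kappa] -> is_vbasis e ->
  moved_off_finite (GL_action V).
Proof.
move=> ik eP r w B w1.
have [g gB gw] := regular_fixing_not_scalar (vbasis_separates eP)
  (vbasis_infinite eP ^~ ik) B w1.
exists g; split=> // gw1; apply: gw; rewrite gw1; exact: scalar_maps1.
Qed.

(** Constants are lifted to coset representatives, which [rk] does not see. *)
Lemma lift_PGL_word (K : fieldType) (V : lmodType K) r (w : word (PGL V) r) :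
  exists2 w' : word (GL V) r, rk w' = rk w &
    forall g, word_eval (fun i => coset_class (GL_scalars V) (g i)) w =
              coset_class (GL_scalars V) (word_eval g w').
Proof.
elim/word_ind: w => [|c w [w' rkw w'E]|t w [w' rkw w'E]].
- by exists 1 => [|g]; rewrite !gmulf1.
- exists (const r (coset_repr c) * w'); first by rewrite !rkM rkw !rk_const.
  move=> g; rewrite !evalM !eval_const w'E -[in LHS](coset_reprK c).
  exact: qmulE.
exists (wletter _ t * w'); first by rewrite !rkM rkw !rk_wletter.
move=> g; rewrite !evalM !eval_wletter w'E -[RHS]qmulE; congr (_ * _).
by rewrite /signed; case: t.2; rewrite // [LHS]qinvE.
Qed.

Lemma PGL_moved_off (K : fieldType) (V : lmodType K) (kappa : choiceType)
    (e : kappa -> V) : infinite_set [set: kappa] -> is_vbasis e ->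
  moved_off_finite (PGL_action V).
Proof.
move=> ik eP r w B w1; have [w' rkw w'E] := lift_PGL_word w.
(* A linear map that fixes a spanning vector of a line fixes the line. *)
pose rep (L : proj_space V) := projT1 (cid2 (line_dim1 L)).
have repE L : line L = [set (c *: rep L)%R | c in [set: K]].
  by rewrite /rep; case: cid2.
have [|g gB gw] := regular_fixing_not_scalar (w := w') (vbasis_separates eP)
  (vbasis_infinite eP ^~ ik) (map rep B); first by rewrite rkw.
exists (fun i => coset_class (GL_scalars V) (g i)); split=> [i L LB|].
  rewrite /= PGL_actE; apply: proj_eqP; rewrite /= repE.
  have gL : g i (rep L) = rep L by apply: gB; exact: map_f.
  apply/seteqP; split=> [_ [_ [c _ <-] <-]|_ [c _ <-]].
    by exists c => //; rewrite GL_scale gL.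
  by exists (c *: rep L)%R; [exists c|rewrite GL_scale gL].
rewrite w'E => /esym/coset_classP /=; rewrite invg1 mul1g; exact: gw.
Qed.

Lemma admissible_moved_off (G : groupType) (Omega : choiceType)
  (to : action G Omega) : admissible to -> moved_off_finite to.
Proof.
case=> {G Omega to} [G Omega to|K V kappa e|K V kappa e].
- exact: degenerate_moved_off.
- exact: GL_moved_off.
- exact: PGL_moved_off.
Qed.

Theorem corollary4p5 (G : groupType) (Omega : choiceType)
    (to : action G Omega) :
  (faithful to -> infinite_set [set: Omega] -> no_algebraicity to ->
     degenerate_kind to) /\
  (admissible to -> forall r : nat, (1 <= r)%N ->
     (forall w : word G r, regular w ->
        dense ([set g | word_eval g w <> 1] :
          set {ptws 'I_r -> pointwise_group to})) /\
     (forall w : word G r, mixed_identity w -> singular w)).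
Proof.
split; first exact: no_algebraicity_kind.
move=> /admissible_moved_off mo r _; split=> w; first exact: regular_dense.
move=> wid; apply: contrapT => w1.
by have [g [_]] := mo r w [::] w1; apply.
Qed.
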